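(* For every triangle, the following bounds hold, where a bound $L\le \frac{D(n,i)}{D(n,j)}\le U$ means $L\,D(n,j)\le D(n,i)\le U\,D(n,j)$ (and similarly for one-sided bounds and equalities): $$\frac{D(1,2)}{D(1,3)}\le \frac23,\quad \frac{2\sqrt2}{3}\le\frac{D(1,2)}{D(1,6)},\quad \frac13\le\frac{D(1,2)}{D(1,7)},\quad \frac{D(1,2)}{D(1,8)}=\frac13,\quad \frac13\le\frac{D(1,2)}{D(1,9)}\le\frac23,\quad \frac{D(1,2)}{D(1,10)}=\frac23,$$ $$\frac12\le\frac{D(1,3)}{D(1,4)},\quad 2\le\frac{D(1,3)}{D(1,5)},\quad 1+\sqrt3\le\frac{D(1,3)}{D(1,6)},\quad \frac32+\sqrt2\le\frac{D(1,3)}{D(1,7)},\quad \frac12\le\frac{D(1,3)}{D(1,8)},\quad 1\le\frac{D(1,3)}{D(1,9)},\quad 1\le\frac{D(1,3)}{D(1,10)},$$ $$1\le\frac{D(1,4)}{D(1,6)},\quad 2\le\frac{D(1,4)}{D(1,7)},\quad \frac13\le\frac{D(1,6)}{D(1,7)},\quad \frac{D(1,6)}{D(1,8)}\le\frac1{2\sqrt2},\quad \frac{D(1,6)}{D(1,9)}\le\frac12,\quad \frac{D(1,6)}{D(1,10)}\le\frac1{\sqrt2},$$ $$\frac{D(1,7)}{D(1,8)}\le1,\quad \frac{D(1,7)}{D(1,9)}\le1,\quad \frac{D(1,7)}{D(1,10)}\le2,\quad 1\le\frac{D(1,8)}{D(1,9)}\le2,\quad \frac{D(1,8)}{D(1,10)}=2,\quad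 1\le\frac{D(1,9)}{D(1,10)}\le2.$$
   Context: For a (nondegenerate) triangle $ABC$ with side lengths $a=BC$, $b=CA$, $c=AB$, a point with barycentric coordinates $(u:v:w)$ is $(uA+vB+wC)/(u+v+w)$. For $1\le n\le 10$ the triangle center $X_n$ is the point with barycentric coordinates $(f_n(a,b,c):f_n(b,c,a):f_n(c,a,b))$, where $f_1=a$ (incenter); $f_2=1$ (centroid); $f_3=a^2(a^2-b^2-c^2)$ (circumcenter); $f_4=(a^2+b^2-c^2)(a^2-b^2+c^2)$ (orthocenter); $f_5=c^4-a^2b^2+b^4-a^2c^2-2b^2c^2$ (nine-point center); $f_6=a^2$ (symmedian point); $f_7=(a+b-c)(a-b+c)$ (Gergonne point); $f_8=a-b-c$ (Nagel point); $f_9=a(a-b-c)$ (mittenpunkt); $f_{10}=b+c$ (Spieker center). $D(i,j)$ denotes the Euclidean distance between $X_i$ and $X_j$. *)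

(* Defs.v *)
From Stdlib Require Import Reals.

Open Scope R_scope.

Definition point : Type := (R * R)%type.

Definition point_dist (P Q : point) : R := dist_euc (fst P) (snd P) (fst Q) (snd Q).

Definition collinear (A B C : point) : Prop :=
  exists p q r : R, (p <> 0 \/ q <> 0) /\
    p * fst A + q * snd A = r /\
    p * fst B + q * snd B = r /\
    p * fst C + q * snd C = r.

Definition barycentric (A B C : point) (u v w : R) : point :=
  ((u * fst A + v * fst B + w * fst C) / (u + v + w),
   (u * snd A + v * snd B + w * snd C) / (u + v + w)).

(* First barycentric coordinate of the n-th center in terms of the side
   lengths; only the indices 1 to 10 are meaningful. *)
Definition center_coord (n : nat) (a b c : R) : R :=
  match n with
  | 1%nat => a                                                   (* incenter *)
  | 2%nat => 1                                                   (* centroid *)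
  | 3%nat => a ^ 2 * (a ^ 2 - b ^ 2 - c ^ 2)                     (* circumcenter *)
  | 4%nat => (a ^ 2 + b ^ 2 - c ^ 2) * (a ^ 2 - b ^ 2 + c ^ 2)   (* orthocenter *)
  | 5%nat => c ^ 4 - a ^ 2 * b ^ 2 + b ^ 4 - a ^ 2 * c ^ 2
             - 2 * b ^ 2 * c ^ 2                                 (* nine-point center *)
  | 6%nat => a ^ 2                                               (* symmedian point *)
  | 7%nat => (a + b - c) * (a - b + c)                           (* Gergonne point *)
  | 8%nat => a - b - c                                           (* Nagel point *)
  | 9%nat => a * (a - b - c)                                     (* mittenpunkt *)
  | 10%nat => b + c                                              (* Spieker center *)
  | _ => 0
  end.

Definition center (A B C : point) (n : nat) : point :=
  let a := point_dist B C in
  let b := point_dist C A in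
  let c := point_dist A B in
  barycentric A B C
    (center_coord n a b c) (center_coord n b c a) (center_coord n c a b).

Definition D (A B C : point) (i j : nat) : R :=
  point_dist (center A B C i) (center A B C j).

(* Main.v *)
(* Let x, y, z be the tangent lengths of the triangle, so a = y + z and so on, and
   scale it so that the inradius is 1.  Every D(1,n)^2 is then a rational function
   of the squared semiperimeter q and t = xy + yz + zx = 4R + 1.  For fixed t,
   Blundon's inequality confines q to an interval whose endpoints are attained by
   isosceles triangles, which admit a rational parametrization by one variable k.
   Each bound, squared, becomes a polynomial inequality in q that is monotone (or,
   in two cases, monotone or concave on the part where it is delicate), so it
   reduces to the endpoints, where it has one variable and factors. *)

Require Import Defs.
From Stdlib Require Import Reals.
From Stdlib Require Import Lra Psatz.
Open Scope R_scope.

(** * Distances and nondegenerate triangles *)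

Lemma point_dist_sq (P Q : point) :
  point_dist P Q ^ 2 = (fst P - fst Q) ^ 2 + (snd P - snd Q) ^ 2.
Proof.
unfold point_dist, dist_euc; rewrite pow2_sqrt; [unfold Rsqr; ring |].
apply Rplus_le_le_0_compat; apply Rle_0_sqr.
Qed.

Lemma point_dist_ge0 (P Q : point) : 0 <= point_dist P Q.
Proof. apply sqrt_pos. Qed.

Lemma collinear_of_det (A B C : point) :
  (fst B - fst A) * (snd C - snd A) = (fst C - fst A) * (snd B - snd A) ->
  collinear A B C.
Proof.
intros H.
destruct (Req_dec (fst B) (fst A)) as [e1|n1].
- destruct (Req_dec (snd B) (snd A)) as [e2|n2].
  + destruct (Req_dec (fst C) (fst A)) as [e3|n3].
    * exists 1, 0, (fst A); rewrite e1, e3; repeat split; [left|..]; lra.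
    * exists (snd C - snd A), (fst A - fst C),
        ((snd C - snd A) * fst A + (fst A - fst C) * snd A).
      rewrite e1, e2; repeat split; [right; lra | ring].
  + exists (snd B - snd A), (fst A - fst B),
        ((snd B - snd A) * fst A + (fst A - fst B) * snd A).
    repeat split; [left; lra | ring | lra].
- exists (snd B - snd A), (fst A - fst B),
        ((snd B - snd A) * fst A + (fst A - fst B) * snd A).
  repeat split; [right; lra | ring | lra].
Qed.

(** By Heron's formula the product of the three differences and the perimeter is a positive multiple
    of the squared area. Two of the differences cannot both be negative, since they add up to twice
    a side. *)
Lemma triangle_strict (A B C : point) :
  ~ collinear A B C ->
  let a := point_dist B C in let b := point_dist C A in let c := point_dist A B in
  0 < b + c - a /\ 0 < c + a - b /\ 0 < a + b - c.
Proof.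
intros H a b c.
assert (Ha := point_dist_ge0 B C : 0 <= a).
assert (Hb := point_dist_ge0 C A : 0 <= b).
assert (Hc := point_dist_ge0 A B : 0 <= c).
assert (heron : (a + b + c) * ((b + c - a) * (c + a - b) * (a + b - c)) =
  4 * ((fst B - fst A) * (snd C - snd A) - (fst C - fst A) * (snd B - snd A)) ^ 2).
(* This form contains the sides only through their squares, which are polynomials in the
   coordinates. *)
{ transitivity (2 * (a ^ 2 * b ^ 2 + b ^ 2 * c ^ 2 + c ^ 2 * a ^ 2)
    - (a ^ 2 * a ^ 2 + b ^ 2 * b ^ 2 + c ^ 2 * c ^ 2)); [ring |].
  unfold a, b, c; rewrite !point_dist_sq; ring. }
assert (det : (fst B - fst A) * (snd C - snd A) - (fst C - fst A) * (snd B - snd A) <> 0).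
{ intros e; apply H, collinear_of_det; lra. }
assert (pos := Rsqr_pos_lt _ det); rewrite Rsqr_pow2 in pos.
assert (prod : 0 < (b + c - a) * (c + a - b) * (a + b - c)) by nra.
clear heron det pos H.
destruct (Rlt_or_le 0 (b + c - a)) as [p1|p1];
destruct (Rlt_or_le 0 (c + a - b)) as [p2|p2];
destruct (Rlt_or_le 0 (a + b - c)) as [p3|p3]; try (repeat split; assumption);
exfalso.
- assert (0 < (b + c - a) * (c + a - b)) by nra; nra.
- assert (0 < (b + c - a) * (a + b - c)) by nra; nra.
- assert (c + a - b = 0 \/ c + a - b < 0) as [e|?] by lra; [rewrite e in prod|]; nra.
- assert (0 < (c + a - b) * (a + b - c)) by nra; nra.
- assert (b + c - a = 0 \/ b + c - a < 0) as [e|?] by lra; [rewrite e in prod|]; nra.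
- assert (b + c - a = 0 \/ b + c - a < 0) as [e|?] by lra; [rewrite e in prod|]; nra.
- assert (b + c - a = 0 \/ b + c - a < 0) as [e|?] by lra; [rewrite e in prod|]; nra.
Qed.

(** * Squared distances from the incenter *)

(** The classical distance formula for a displacement whose normalized barycentric coordinates [d],
    [e], [f] sum to zero. *)
Lemma barycentric_dist_sq (A B C : point) (u v w u' v' w' : R) :
  u + v + w <> 0 -> u' + v' + w' <> 0 ->
  let d := u / (u + v + w) - u' / (u' + v' + w') in
  let e := v / (u + v + w) - v' / (u' + v' + w') in
  let f := w / (u + v + w) - w' / (u' + v' + w') in
  point_dist (barycentric A B C u v w) (barycentric A B C u' v' w') ^ 2 =
  - (point_dist B C ^ 2 * e * f + point_dist C A ^ 2 * f * d + point_dist A B ^ 2 * d * e).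
Proof.
intros h h'; rewrite !point_dist_sq; simpl; field; auto.
Qed.

(* With tangent lengths [x], [y], [z] and inradius [r] one has
   IA . IA = r^2 + x^2 and IA . IB = r^2 - x * y. *)
Lemma incenter_dist_sq (A B C : point) (x y z u v w : R) :
  point_dist B C = y + z -> point_dist C A = z + x -> point_dist A B = x + y ->
  x + y + z <> 0 -> u + v + w <> 0 ->
  point_dist (center A B C 1) (barycentric A B C u v w) ^ 2 =
  x * y * z / (x + y + z) +
  (2 * ((u * x) ^ 2 + (v * y) ^ 2 + (w * z) ^ 2) - (u * x + v * y + w * z) ^ 2)
    / (u + v + w) ^ 2.
Proof.
intros ha hb hc h1 h2; unfold center, center_coord; rewrite ha, hb, hc.
assert (h3 : y + z + (z + x) + (x + y) <> 0) by (intros e; apply h1; lra).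
rewrite barycentric_dist_sq; [rewrite ha, hb, hc; field; auto | auto | auto].
Qed.

(* Squared distance from the incenter to [X_n] for inradius [r = 1], where
   [q] is the squared semiperimeter and [t = 4 * R + 1], [R] the circumradius. *)
Definition incenter_sq (n : nat) (q t : R) : R :=
  match n with
  | 2%nat => (q - 4 * t + 9) / 9
  | 3%nat => (t - 1) * (t - 9) / 16
  | 4%nat => (t ^ 2 + 2 * t + 9) / 4 - q
  | 5%nat => (t - 9) ^ 2 / 64
  | 6%nat => (t - 1) * (q * (t + 3) - 4 * t ^ 2) / (4 * (q - t) ^ 2)
  | 7%nat => 1 - 3 * q / t ^ 2
  | 8%nat => q - 4 * t + 9
  | 9%nat => (t - 1) * (q * (t + 3) - 4 * t ^ 2) / (4 * t ^ 2)
  | 10%nat => (q - 4 * t + 9) / 4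
  | _ => 0
  end.

Lemma D_sq (A B C : point) (x y z : R) (n : nat) :
  point_dist B C = y + z -> point_dist C A = z + x -> point_dist A B = x + y ->
  0 < x -> 0 < y -> 0 < z -> (2 <= n <= 10)%nat ->
  let s := x + y + z in
  let r2 := x * y * z / s in
  D A B C 1 n ^ 2 = r2 * incenter_sq n (s ^ 2 / r2) ((x * y + y * z + z * x) / r2).
Proof.
intros ha hb hc hx hy hz hn s r2.
assert (hs : 0 < x + y + z) by lra.
assert (hxy := Rmult_lt_0_compat _ _ hx hy).
assert (hyz := Rmult_lt_0_compat _ _ hy hz).
assert (hzx := Rmult_lt_0_compat _ _ hz hx).
assert (hxyz := Rmult_lt_0_compat _ _ hxy hz).
assert (he2 : 0 < x * y + y * z + z * x) by lra.
assert (hxyzs := Rmult_lt_0_compat _ _ hxyz hs).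
unfold D, center at 2; rewrite ha, hb, hc.
assert (hn' : (n = 2 \/ n = 3 \/ n = 4 \/ n = 5 \/ n = 6 \/ n = 7 \/ n = 8 \/ n = 9 \/ n = 10)%nat)
  by lia.
repeat (destruct hn' as [-> | hn']); [.. | subst n];
  (rewrite (incenter_dist_sq A B C x y z); trivial; [| lra | ]);
  unfold r2, s, center_coord, incenter_sq; clear r2 s ha hb hc hn.
(* For each center there remain a rational identity in [x], [y], [z] and the nonvanishing of the sum
   of its barycentric coordinates. *)
all: first [nra | field; repeat split; nra].
Qed.

(** * Blundon's inequality and its isosceles endpoints *)

(* Euler's inequality [2 <= R] and Blundon's inequality; the latter amounts to
   [0 <= ((x - y) * (y - z) * (z - x)) ^ 2] for the tangent lengths [x], [y], [z]. *)
Definition blundon (q t : R) : Prop :=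
  9 <= t /\ 4 * q ^ 2 - (t ^ 2 + 18 * t - 27) * q + 4 * t ^ 3 <= 0.

Lemma blundon_tangent_lengths (x y z : R) :
  0 < x -> 0 < y -> 0 < z ->
  let s := x + y + z in
  let r2 := x * y * z / s in
  blundon (s ^ 2 / r2) ((x * y + y * z + z * x) / r2).
Proof.
intros hx hy hz s r2.
assert (hxy := Rmult_lt_0_compat _ _ hx hy).
assert (hxyz := Rmult_lt_0_compat _ _ hxy hz).
assert (hs : 0 < s) by (unfold s; lra).
assert (hi := Rinv_0_lt_compat _ hxyz).
split.
- assert (h : (x * y + y * z + z * x) / r2 - 9 =
    (x * (y - z) ^ 2 + y * (z - x) ^ 2 + z * (x - y) ^ 2) * / (x * y * z)).
  { unfold r2, s; field; repeat split; lra. }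
  enough (0 <= (x * (y - z) ^ 2 + y * (z - x) ^ 2 + z * (x - y) ^ 2) * / (x * y * z)) by lra.
  apply Rmult_le_pos; [|lra].
  assert (h1 := Rmult_le_pos _ _ (Rlt_le _ _ hx) (pow2_ge_0 (y - z))).
  assert (h2 := Rmult_le_pos _ _ (Rlt_le _ _ hy) (pow2_ge_0 (z - x))).
  assert (h3 := Rmult_le_pos _ _ (Rlt_le _ _ hz) (pow2_ge_0 (x - y))).
  lra.
- match goal with |- ?l <= 0 =>
    assert (h : - l = ((x - y) * (y - z) * (z - x) / (x * y * z)) ^ 2
      * ((s / (x * y * z)) * s ^ 2)) end.
  { unfold r2, s; field; repeat split; unfold s in hs; lra. }
  enough (0 <= ((x - y) * (y - z) * (z - x) / (x * y * z)) ^ 2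
    * ((s / (x * y * z)) * s ^ 2)) by lra.
  apply Rmult_le_pos; [apply pow2_ge_0|].
  apply Rmult_le_pos; [unfold Rdiv; nra | apply pow2_ge_0].
Qed.

(* Isosceles triangles with inradius 1 are the equality case of Blundon's
   inequality; [k] is the square of the repeated tangent length. *)
Definition iso_t (k : R) : R := k * (k + 3) / (k - 1).
Definition iso_q (k : R) : R := 4 * k ^ 3 / (k - 1) ^ 2.

(** For fixed [t], the equation [iso_t k = t] is quadratic in [k] with discriminant
    [(t - 1) * (t - 9)]. Its roots lie on either side of 3, the equilateral value, and [iso_q] maps
    them to the two roots in [q] of Blundon's quadratic. *)
Lemma blundon_range (q t : R) : blundon q t ->
  exists j k : R, 1 < j <= 3 /\ 3 <= k /\ t = iso_t j /\ t = iso_t k /\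
    iso_q k <= q <= iso_q j.
Proof.
intros [ht hF].
set (d := sqrt ((t - 1) * (t - 9))).
assert (hd : d ^ 2 = (t - 1) * (t - 9)) by (apply pow2_sqrt; nra).
assert (hd0 : 0 <= d) by apply sqrt_pos.
set (k := (t - 3 + d) / 2).
assert (hk : 3 <= k) by (unfold k; lra).
assert (htk : t = iso_t k).
{ unfold iso_t; apply (Rmult_eq_reg_r (k - 1)); [field_simplify|]; [|lra..].
  unfold k; nra. }
clearbody k; clear d hd hd0.
(* The other root: the roots have sum [t - 3] and product [t], hence [(j - 1) * (k - 1) = 4]. *)
set (j := 1 + 4 / (k - 1)).
assert (hj : 1 < j <= 3).
{ assert (0 < / (k - 1)) by (apply Rinv_0_lt_compat; lra).
  assert (0 <= 2 - 4 / (k - 1)).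
  { replace (2 - 4 / (k - 1)) with (2 * (k - 3) * / (k - 1)) by (field; lra); nra. }
  unfold j, Rdiv in *; lra. }
exists j, k; repeat split; try lra.
{ rewrite htk; unfold iso_t, j; field; lra. }
all: assert (hfac : 4 * ((q - iso_q k) * (iso_q j - q)) =
    - (4 * q ^ 2 - (t ^ 2 + 18 * t - 27) * q + 4 * t ^ 3)) by
  (rewrite htk; unfold iso_t, iso_q, j; field; lra).
all: assert (hle : iso_q j - iso_q k = (k - 3) ^ 3 * (k + 1) / (4 * (k - 1) ^ 2)) by
  (unfold iso_q, j; field; lra).
all: assert (0 <= (k - 3) ^ 3 * (k + 1) / (4 * (k - 1) ^ 2)) by
  (apply Rmult_le_pos;
   [apply Rmult_le_pos; [apply pow_le|]; lra | apply Rlt_le, Rinv_0_lt_compat; nra]).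
all: nra.
Qed.

(** * Gerretsen's inequalities and their direct consequences *)

Lemma le_div (u v w : R) : 0 < v -> w * v <= u -> w <= u / v.
Proof.
intros hv h; apply (Rmult_le_reg_r v); trivial.
unfold Rdiv; rewrite Rmult_assoc, Rinv_l; lra.
Qed.

Lemma div_le (u v w : R) : 0 < v -> u <= w * v -> u / v <= w.
Proof.
intros hv h; apply (Rmult_le_reg_r v); trivial.
unfold Rdiv; rewrite Rmult_assoc, Rinv_l; lra.
Qed.

(** In an isosceles triangle the centers lie on the axis of symmetry, which is why their squared
    distances become squares of rational functions of [k]. *)
Lemma iso_nagel (k : R) : 1 < k -> iso_q k - 4 * iso_t k + 9 = ((k - 3) / (k - 1)) ^ 2.
Proof. intros hk; unfold iso_q, iso_t; field; lra. Qed.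

Lemma iso_orthocenter (k : R) : 1 < k -> iso_t k ^ 2 + 2 * iso_t k + 9 - 4 * iso_q k = (k - 3) ^ 2.
Proof. intros hk; unfold iso_q, iso_t; field; lra. Qed.

(** These say that the squared distances to the Nagel point and the orthocenter are nonnegative. The
    first increases with [q] and is checked at the lower endpoint; the second decreases and is
    checked at the upper one. *)
Lemma gerretsen (q t : R) : blundon q t ->
  4 * t - 9 <= q /\ 4 * q <= t ^ 2 + 2 * t + 9.
Proof.
intros (j & k & hj & hk & htj & htk & hq)%blundon_range.
assert (h1 := iso_nagel k ltac:(lra)); assert (h2 := iso_orthocenter j ltac:(lra)).
rewrite <- htk in h1; rewrite <- htj in h2.
assert (h3 := pow2_ge_0 ((k - 3) / (k - 1))); assert (h4 := pow2_ge_0 (j - 3)).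
lra.
Qed.

(** Gerretsen's upper bound on [q] makes the left side at most [(t - 5) * (t - 9) / 4]; in the next
    lemma the lower bound does the same. *)
Lemma nagel_le_circumcenter (q t : R) : blundon q t ->
  incenter_sq 8 q t <= 4 * incenter_sq 3 q t.
Proof. intros h; destruct (gerretsen q t h), h; simpl; nra. Qed.

Lemma orthocenter_le_circumcenter (q t : R) : blundon q t ->
  incenter_sq 4 q t <= 4 * incenter_sq 3 q t.
Proof. intros h; destruct (gerretsen q t h), h; simpl; nra. Qed.

(** For inradius 1 the distances are [R / 2 - 1] by Feuerbach's theorem and the square root of
    [R * (R - 2)] by Euler's. *)
Lemma nine_point_le_circumcenter (q t : R) : blundon q t ->
  4 * incenter_sq 5 q t <= incenter_sq 3 q t.
Proof. intros h; destruct (gerretsen q t h), h; simpl; nra. Qed.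

Lemma mittenpunkt_le_circumcenter (q t : R) : blundon q t ->
  incenter_sq 9 q t <= incenter_sq 3 q t.
Proof.
intros h; destruct (gerretsen q t h) as [h1 h2], h as [ht _]; simpl.
apply div_le; [nra|].
replace ((t - 1) * (t - 9) / 16 * (4 * (t * (t * 1))))
  with ((t - 1) * (t ^ 2 * (t - 9) / 4)) by field.
apply Rmult_le_compat_l; [lra|].
assert (q * (t + 3) <= (t ^ 2 + 2 * t + 9) / 4 * (t + 3)) by (apply Rmult_le_compat_r; lra).
(* Four times the slack that remains once [q] is replaced by Gerretsen's upper bound. *)
assert (0 <= (2 * t + 3) * (t - 9)) by nra.
lra.
Qed.

Lemma nagel_le_mittenpunkt (q t : R) : blundon q t ->
  incenter_sq 8 q t <= 4 * incenter_sq 9 q t.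
Proof.
intros h; destruct (gerretsen q t h) as [h1 h2], h as [ht _]; simpl.
match goal with |- _ <= 4 * (?n / (4 * ?d)) =>
  replace (4 * (n / (4 * d))) with (n / d) by (field; nra) end.
apply le_div; [nra|].
(* After clearing denominators the difference of the sides is [q * (2 * t - 3) - 5 * t ^ 2], which
   equals [3 * (t - 1) * (t - 9)] at [q = 4 * t - 9]. *)
assert (0 <= (q - (4 * t - 9)) * (2 * t - 3)) by (apply Rmult_le_pos; lra).
assert (0 <= (t - 1) * (t - 9)) by (apply Rmult_le_pos; lra).
nra.
Qed.

(** Both squared distances have the same numerator, so only denominators are compared:
    [q - t >= 3 * t - 9 >= 2 * t]. *)
Lemma symmedian_le_mittenpunkt (q t : R) : blundon q t ->
  4 * incenter_sq 6 q t <= incenter_sq 9 q t.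
Proof.
intros h; destruct (gerretsen q t h) as [h1 h2], h as [ht _]; simpl.
set (e := (t - 1) * (q * (t + 3) - 4 * (t * (t * 1)))).
assert (he : 0 <= e).
{ apply Rmult_le_pos; [lra|].
  assert ((4 * t - 9) * (t + 3) <= q * (t + 3)) by (apply Rmult_le_compat_r; lra).
  lra. }
apply le_div; [nra|].
replace (4 * (e / (4 * ((q - t) * ((q - t) * 1)))) * (4 * (t * (t * 1))))
  with (e * (2 * t / (q - t)) ^ 2) by (field; lra).
assert (0 <= 2 * t / (q - t) <= 1).
{ split; [apply Rmult_le_pos; [|apply Rlt_le, Rinv_0_lt_compat]; lra | apply div_le; lra]. }
assert ((2 * t / (q - t)) ^ 2 <= 1) by (rewrite <- (pow1 2); apply pow_incr; lra).
rewrite <- (Rmult_1_r e) at 2; apply Rmult_le_compat_l; lra.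
Qed.

(** * Bounds for the Gergonne point and the mittenpunkt at the endpoints *)

Lemma gergonne_eq (q t : R) : 9 <= t -> incenter_sq 7 q t = (t ^ 2 - 3 * q) / t ^ 2.
Proof. intros ht; simpl; field; lra. Qed.

Lemma iso_gergonne (k : R) : 1 < k ->
  1 - 3 * iso_q k / iso_t k ^ 2 = ((k - 3) / (k + 3)) ^ 2.
Proof. intros hk; unfold iso_q, iso_t; field; repeat split; lra. Qed.

Lemma gergonne_le_iso (q t k : R) : 9 <= t -> iso_q k <= q -> t = iso_t k -> 1 < k ->
  incenter_sq 7 q t <= ((k - 3) / (k + 3)) ^ 2.
Proof.
intros ht hq hk hk1; rewrite <- iso_gergonne, <- hk; [|lra]; simpl.
assert (hi : 0 < / (t * (t * 1))) by (apply Rinv_0_lt_compat; nra).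
assert (3 * iso_q k * / (t * (t * 1)) <= 3 * q * / (t * (t * 1)))
  by (apply Rmult_le_compat_r; lra).
unfold Rdiv; lra.
Qed.

(** As [q] grows the left side decreases and the right side increases, so the lower endpoint is the
    worst case. *)
Lemma gergonne_le_nagel (q t : R) : blundon q t -> incenter_sq 7 q t <= incenter_sq 8 q t.
Proof.
intros h; destruct (blundon_range q t h) as (j & k & hj & hk & htj & htk & hq).
assert (h1 := iso_nagel k ltac:(lra)); rewrite <- htk in h1.
assert (h2 := gergonne_le_iso q t k (proj1 h) (proj1 hq) htk ltac:(lra)).
assert (((k - 3) / (k + 3)) ^ 2 <= ((k - 3) / (k - 1)) ^ 2).
{ apply pow_incr; split.
  - apply Rmult_le_pos; [|apply Rlt_le, Rinv_0_lt_compat]; lra.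
  - apply Rmult_le_compat_l; [lra|]; apply Rinv_le_contravar; lra. }
unfold incenter_sq at 2; lra.
Qed.

Lemma gergonne_le_circumcenter (q t : R) : blundon q t ->
  (3 / 2 + sqrt 2) ^ 2 * incenter_sq 7 q t <= incenter_sq 3 q t.
Proof.
intros h; destruct (blundon_range q t h) as (j & k & hj & hk & htj & htk & hq).
assert (h2 := gergonne_le_iso q t k (proj1 h) (proj1 hq) htk ltac:(lra)).
assert (e : incenter_sq 3 q t = ((k - 3) / (k + 3) * ((k + 1) * (k + 3) / (4 * (k - 1)))) ^ 2).
{ rewrite htk; unfold iso_t; simpl; field; split; lra. }
rewrite e; apply Rle_trans with ((3 / 2 + sqrt 2) ^ 2 * ((k - 3) / (k + 3)) ^ 2).
{ apply Rmult_le_compat_l; [apply pow2_ge_0 | exact h2]. }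
rewrite <- Rpow_mult_distr.
assert (0 <= (k - 3) / (k + 3)).
{ apply Rmult_le_pos; [|apply Rlt_le, Rinv_0_lt_compat]; lra. }
assert (r0 := sqrt_pos 2); assert (r2 : sqrt 2 ^ 2 = 2) by (apply pow2_sqrt; lra).
apply pow_incr; split; [apply Rmult_le_pos; lra|].
rewrite Rmult_comm; apply Rmult_le_compat_l; [lra|].
apply le_div; [lra|].
(* The ratio [(k + 1) * (k + 3) / (4 * (k - 1))] attains its minimum [3 / 2 + sqrt 2] at
   [k = 1 + 2 * sqrt 2]. *)
assert (hsq := pow2_ge_0 (k - 1 - 2 * sqrt 2)); nra.
Qed.

Lemma gergonne_le_orthocenter (q t : R) : blundon q t ->
  4 * incenter_sq 7 q t <= incenter_sq 4 q t.
Proof.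
intros h; destruct (blundon_range q t h) as (j & k & hj & hk & htj & htk & hq).
destruct h as [ht _].
assert (h1 := iso_orthocenter j ltac:(lra)); rewrite <- htj in h1.
assert (h2 := iso_gergonne j ltac:(lra)); rewrite <- htj in h2.
assert (16 * ((j - 3) / (j + 3)) ^ 2 <= (j - 3) ^ 2).
{ replace (16 * ((j - 3) / (j + 3)) ^ 2) with ((j - 3) ^ 2 * (4 * / (j + 3)) ^ 2)
    by (field; lra).
  assert (0 <= 4 * / (j + 3) <= 1).
  { split; [assert (0 < / (j + 3)) by (apply Rinv_0_lt_compat; lra); lra|].
    change (4 * / (j + 3)) with (4 / (j + 3)); apply div_le; lra. }
  rewrite <- (Rmult_1_r ((j - 3) ^ 2)) at 2; apply Rmult_le_compat_l; [apply pow2_ge_0|].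
  rewrite <- (pow1 2); apply pow_incr; lra. }
assert (hi : / t ^ 2 <= / 81) by (apply Rinv_le_contravar; nra).
(* The difference of the two sides is affine in [q] with slope [12 / t ^ 2 - 1 < 0], so it is
   smallest at the upper endpoint. *)
assert (hd : (q - iso_q j) * (1 - 12 * / t ^ 2) <= 0) by nra.
unfold incenter_sq, Rdiv in *; lra.
Qed.

Lemma mittenpunkt_le_nagel (q t : R) : blundon q t -> incenter_sq 9 q t <= incenter_sq 8 q t.
Proof.
intros h; destruct (blundon_range q t h) as (j & k & hj & hk & htj & htk & hq).
destruct h as [ht _]; unfold incenter_sq.
apply div_le; [nra|].
(* The cleared inequality is affine in [q] with this positive slope, which reduces it to the lower
   endpoint. *)
assert (h0 : 0 <= (q - iso_q k) * (3 * t ^ 2 - 2 * t + 3)) by (apply Rmult_le_pos; nra).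
assert (h1 : 4 * t ^ 2 * (iso_q k - 4 * t + 9) - (t - 1) * (iso_q k * (t + 3) - 4 * t ^ 2)
  = 16 * (k + 2) * (k * (k - 3) / (k - 1) ^ 2) ^ 2).
{ rewrite htk; unfold iso_t, iso_q; field; lra. }
assert (h2 : 0 <= 16 * (k + 2) * (k * (k - 3) / (k - 1) ^ 2) ^ 2).
{ apply Rmult_le_pos; [lra | apply pow2_ge_0]. }
lra.
Qed.

Lemma gergonne_le_mittenpunkt (q t : R) : blundon q t -> incenter_sq 7 q t <= incenter_sq 9 q t.
Proof.
intros h; destruct (blundon_range q t h) as (j & k & hj & hk & htj & htk & hq).
destruct h as [ht _]; rewrite gergonne_eq; trivial; unfold incenter_sq.
apply le_div; [nra|].
replace ((t ^ 2 - 3 * q) / t ^ 2 * (4 * t ^ 2)) with (4 * (t ^ 2 - 3 * q)) by (field; lra).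
assert (h0 : 0 <= (q - iso_q k) * (t ^ 2 + 2 * t + 9)) by (apply Rmult_le_pos; nra).
assert (h1 : (t - 1) * (iso_q k * (t + 3) - 4 * t ^ 2) - 4 * (t ^ 2 - 3 * iso_q k)
  = 16 * k * (k * (k - 3) / (k - 1) ^ 2) ^ 2).
{ rewrite htk; unfold iso_t, iso_q; field; lra. }
assert (h2 : 0 <= 16 * k * (k * (k - 3) / (k - 1) ^ 2) ^ 2).
{ apply Rmult_le_pos; [lra | apply pow2_ge_0]. }
lra.
Qed.

(** * Bounds for the symmedian point *)

Lemma symmedian_le_nagel (q t : R) : blundon q t -> 8 * incenter_sq 6 q t <= incenter_sq 8 q t.
Proof.
intros h; destruct (gerretsen q t h) as [hg _].
destruct (blundon_range q t h) as (j & k & hj & hk & htj & htk & hq).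
destruct h as [ht _]; unfold incenter_sq.
match goal with |- 8 * (?n / (4 * ?d)) <= _ =>
  replace (8 * (n / (4 * d))) with (2 * n / d) by (field; nra) end.
apply div_le; [nra|].
set (q0 := iso_q k) in *.
assert (hg0 : 4 * t - 9 <= q0).
{ assert (h1 := iso_nagel k ltac:(lra)); rewrite <- htk in h1; fold q0 in h1.
  assert (h2 := pow2_ge_0 ((k - 3) / (k - 1))); lra. }
assert (incr : (q0 - 4 * t + 9) * (q0 - t) ^ 2 - 2 * ((t - 1) * (q0 * (t + 3) - 4 * t ^ 2))
  <= (q - 4 * t + 9) * (q - t) ^ 2 - 2 * ((t - 1) * (q * (t + 3) - 4 * t ^ 2))).
{ assert (0 <= (q0 - 4 * t + 9) * ((q - t) ^ 2 - (q0 - t) ^ 2)).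
  { apply Rmult_le_pos; [lra|].
    assert ((q0 - t) ^ 2 <= (q - t) ^ 2) by (apply pow_incr; lra); lra. }
  assert ((3 * t - 9) ^ 2 <= (q - t) ^ 2) by (apply pow_incr; lra).
  assert (0 <= (q - q0) * ((q - t) ^ 2 - 2 * ((t - 1) * (t + 3)))).
  { apply Rmult_le_pos; nra. }
  lra. }
assert (iso : (q0 - 4 * t + 9) * (q0 - t) ^ 2 - 2 * ((t - 1) * (q0 * (t + 3) - 4 * t ^ 2)) =
  (k * (k - 3) / (k - 1) ^ 3) ^ 2 * ((3 * k ^ 2 - 2 * k + 3) ^ 2 - 8 * (k ^ 2 - 1) ^ 2)).
{ unfold q0; rewrite htk; unfold iso_t, iso_q; field; lra. }
assert (sq : 0 <= (3 * k ^ 2 - 2 * k + 3) ^ 2 - 8 * (k ^ 2 - 1) ^ 2).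
{ assert (r0 := sqrt_pos 2); assert (r2 : sqrt 2 ^ 2 = 2) by (apply pow2_sqrt; lra).
  set (v := sqrt 2) in *.
  (* A perfect square because [(v - 1) * (v + 1) = 1]; it vanishes at [k = 3 + 2 * sqrt 2], where
     the constant is sharp. *)
  assert (e : 3 * k ^ 2 - 2 * k + 3 - 2 * v * (k ^ 2 - 1) = ((v - 1) * k - (v + 1)) ^ 2) by nra.
  assert (hs := pow2_ge_0 ((v - 1) * k - (v + 1))); rewrite <- e in hs.
  assert (hk2 : 0 <= k ^ 2 - 1) by nra.
  assert (0 <= 2 * v * (k ^ 2 - 1)) by (apply Rmult_le_pos; lra).
  replace (8 * (k ^ 2 - 1) ^ 2) with ((2 * v * (k ^ 2 - 1)) ^ 2)
    by (replace 8 with (4 * v ^ 2) by lra; ring).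
  assert ((2 * v * (k ^ 2 - 1)) ^ 2 <= (3 * k ^ 2 - 2 * k + 3) ^ 2) by (apply pow_incr; lra).
  lra. }
assert (0 <= (k * (k - 3) / (k - 1) ^ 3) ^ 2 * ((3 * k ^ 2 - 2 * k + 3) ^ 2 - 8 * (k ^ 2 - 1) ^ 2))
  by (apply Rmult_le_pos; [apply pow2_ge_0 | lra]).
lra.
Qed.

Lemma gergonne_le_symmedian (q t : R) : blundon q t -> incenter_sq 7 q t <= 9 * incenter_sq 6 q t.
Proof.
intros h; destruct (gerretsen q t h) as [hg _].
destruct (blundon_range q t h) as (j & k & hj & hk & htj & htk & hq).
destruct h as [ht _]; rewrite gergonne_eq; trivial; unfold incenter_sq.
apply div_le; [nra|].
match goal with |- _ <= 9 * (?n / (4 * ?d)) * ?c =>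
  replace (9 * (n / (4 * d)) * c) with (9 * c * n / (4 * d)) by (field; nra) end.
apply le_div; [nra|].
set (q0 := iso_q k) in *.
assert (hg0 : 4 * t - 9 <= q0).
{ assert (h1 := iso_nagel k ltac:(lra)); rewrite <- htk in h1; fold q0 in h1.
  assert (h2 := pow2_ge_0 ((k - 3) / (k - 1))); lra. }
set (f := fun q => 9 * t ^ 2 * ((t - 1) * (q * (t + 3) - 4 * t ^ 2)) -
  (t ^ 2 - 3 * q) * (4 * (q - t) ^ 2)).
enough (0 <= f q) by (unfold f in *; lra).
assert (incr : f q0 <= f q).
{ set (m := q - t); set (m0 := q0 - t).
  assert (e : f q - f q0 = (q - q0) *
    (12 * (m ^ 2 + m * m0 + m0 ^ 2) - 4 * (t ^ 2 - 3 * t) * (m + m0)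
      + 9 * t ^ 2 * (t ^ 2 + 2 * t - 3))) by (unfold f, m, m0; ring).
  enough (0 <= f q - f q0) by lra.
  rewrite e; apply Rmult_le_pos; [lra|].
  (* The second factor is a quadratic in [m + m0] plus [3 * (m - m0) ^ 2]; completing the square
     shows it nonnegative. *)
  assert (0 <= (m - m0) ^ 2) by apply pow2_ge_0.
  assert (0 <= (9 * (m + m0) - 2 * (t ^ 2 - 3 * t)) ^ 2) by apply pow2_ge_0.
  assert (0 <= t ^ 2 * (t ^ 2 + 2 * t - 3) - t ^ 2 * (t - 3) ^ 2) by nra.
  assert (0 <= t ^ 2 * (t - 3) ^ 2) by (rewrite <- Rpow_mult_distr; apply pow2_ge_0).
  lra. }
assert (iso : f q0 = 4 * (k / (k - 1) ^ 2) ^ 2 * (k * (k - 3) / (k - 1)) ^ 2 *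
  (9 * ((k + 1) * (k + 3)) ^ 2 - (3 * k ^ 2 - 2 * k + 3) ^ 2)).
{ unfold f, q0; rewrite htk; unfold iso_t, iso_q; field; lra. }
assert (0 <= f q0); [|lra].
rewrite iso; apply Rmult_le_pos.
- apply Rmult_le_pos; [apply Rmult_le_pos; [lra|]|]; apply pow2_ge_0.
- assert ((3 * k ^ 2 - 2 * k + 3) ^ 2 <= (3 * ((k + 1) * (k + 3))) ^ 2) by (apply pow_incr; nra).
  lra.
Qed.

(** With [p = q - t] the cleared inequality says that a cubic [f] is nonnegative. Below its
    inflection point [c / 12] it is bounded below by a quadratic with negative discriminant; beyond
    it, concavity leaves only the two ends to check. *)
Lemma symmedian_le_orthocenter (q t : R) : blundon q t -> incenter_sq 6 q t <= incenter_sq 4 q t.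
Proof.
intros h; destruct (gerretsen q t h) as [hg hg'].
destruct (blundon_range q t h) as (j & k & hj & hk & htj & htk & hq).
destruct h as [ht _]; unfold incenter_sq.
apply div_le; [nra|].
set (c := t ^ 2 - 2 * t + 9).
set (f := fun p => p ^ 2 * (c - 4 * p) - (t - 1) * (p * (t + 3) - 3 * t * (t - 1))).
enough (0 <= f (q - t)) by (unfold f, c in *; lra).
assert (below : forall p, 0 <= p <= c / 12 -> 0 <= f p).
{ intros p hp.
  assert (0 <= p ^ 2 * (c / 12 - p)) by (apply Rmult_le_pos; [apply pow2_ge_0 | lra]).
  assert (0 <= 2 / 3 * c * p ^ 2 - (t - 1) * (t + 3) * p + 3 * t * (t - 1) ^ 2); [|unfold f; lra].
  assert (hc : 0 < c) by (unfold c; nra).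
  assert (0 <= (t - 1) ^ 2 * (8 * t * c - (t + 3) ^ 2)).
  { apply Rmult_le_pos; [apply pow2_ge_0 | unfold c; nra]. }
  assert (0 <= (4 / 3 * c * p - (t - 1) * (t + 3)) ^ 2) by apply pow2_ge_0.
  apply (Rmult_le_reg_l (8 / 3 * c)); lra. }
destruct (Rle_or_lt (q - t) (c / 12)) as [hp|hp]; [apply below; lra|].
set (p := q - t) in *; set (m := c / 12) in *; set (u := iso_q j - t).
assert (hu : p <= u) by (unfold p, u; lra).
assert (fm : 0 <= f m) by (apply below; unfold m, c; nra).
assert (fu : 0 <= f u).
{ assert (e : f u = (j * (j - 3) / (j - 1) ^ 2) ^ 2 *
    ((3 * j ^ 2 - 2 * j + 3) ^ 2 - 4 * (j + 1) ^ 2)).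
  { unfold f, u, c; rewrite htj; unfold iso_t, iso_q; field; lra. }
  rewrite e; apply Rmult_le_pos; [apply pow2_ge_0|].
  assert ((2 * (j + 1)) ^ 2 <= (3 * j ^ 2 - 2 * j + 3) ^ 2) by (apply pow_incr; nra).
  lra. }
(* [f] is concave on [m, +oo): its graph lies above the chord over [m, u]. *)
assert (chord : (u - m) * f p = (u - p) * f m + (p - m) * f u +
  (u - m) * ((p - m) * (u - p) * (4 * (p + m + u) - 12 * m))).
{ unfold f; replace c with (12 * m) by (unfold m; field); ring. }
apply (Rmult_le_reg_l (u - m)); [lra|].
rewrite Rmult_0_r, chord.
assert (0 <= (u - p) * f m) by (apply Rmult_le_pos; lra).
assert (0 <= (p - m) * f u) by (apply Rmult_le_pos; lra).
assert (0 <= (u - m) * ((p - m) * (u - p) * (4 * (p + m + u) - 12 * m))).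
{ repeat apply Rmult_le_pos; lra. }
lra.
Qed.

(** The cleared inequality is quadratic in [p = q - t]. For [t >= 14] its discriminant is not
    positive; for smaller [t] the ratio of the distances is extremal at the upper endpoint. *)
Lemma symmedian_le_circumcenter (q t : R) : blundon q t ->
  (1 + sqrt 3) ^ 2 * incenter_sq 6 q t <= incenter_sq 3 q t.
Proof.
intros h; destruct (gerretsen q t h) as [hg hg'].
destruct (blundon_range q t h) as (j & k & hj & hk & htj & htk & hq).
destruct h as [ht _]; unfold incenter_sq.
assert (r0 := sqrt_pos 3); assert (r3 : sqrt 3 ^ 2 = 3) by (apply pow2_sqrt; lra).
set (v := sqrt 3) in *.
assert (v < 1.75) by (apply Rnot_le_lt; intros hv; nra).
set (p := q - t) in *.
assert (hp : 0 < p) by (unfold p; lra).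
set (w := 4 * (1 + v) ^ 2).
assert (hw : 0 < w < 31) by (unfold w; nra).
enough (main : w * (p * (t + 3) - 3 * t * (t - 1)) <= (t - 9) * p ^ 2).
{ replace ((1 + v) ^ 2 * ((t - 1) * (q * (t + 3) - 4 * t ^ 2) / (4 * p ^ 2)))
    with ((t - 1) * (w * (p * (t + 3) - 3 * t * (t - 1))) / (16 * p ^ 2))
    by (unfold w, p in *; field; lra).
  apply div_le; [nra|].
  replace ((t - 1) * (t - 9) / 16 * (16 * p ^ 2)) with ((t - 1) * ((t - 9) * p ^ 2)) by field.
  apply Rmult_le_compat_l; lra. }
destruct (Rle_or_lt 14 t) as [h14|h14].
- assert (disc : 0 <= w * (12 * t * (t - 1) * (t - 9) - w * (t + 3) ^ 2)).
  { apply Rmult_le_pos; [lra|].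
    assert (w * (t + 3) ^ 2 <= 31 * (t + 3) ^ 2)
      by (apply Rmult_le_compat_r; [apply pow2_ge_0 | lra]).
    nra. }
  assert (0 <= (2 * (t - 9) * p - w * (t + 3)) ^ 2) by apply pow2_ge_0.
  apply (Rmult_le_reg_l (4 * (t - 9))); lra.
- set (u := iso_q j - t).
  assert (hu : p <= u) by (unfold p, u; lra).
  assert (gu : 4 * u <= t ^ 2 - 2 * t + 9).
  { assert (h2 := iso_orthocenter j ltac:(lra)); rewrite <- htj in h2.
    assert (h4 := pow2_ge_0 (j - 3)); unfold u; lra. }
  assert (iso : (t - 9) * u ^ 2 - w * (u * (t + 3) - 3 * t * (t - 1)) =
    (j * (j - 3)) ^ 2 / (j - 1) ^ 5 * ((3 * j ^ 2 - 2 * j + 3) ^ 2 - 4 * w * (j - 1) ^ 2)).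
  { unfold u; rewrite htj; unfold iso_t, iso_q; field; lra. }
  assert (sq : 4 * w * (j - 1) ^ 2 <= (3 * j ^ 2 - 2 * j + 3) ^ 2).
  { replace (4 * w * (j - 1) ^ 2) with ((4 * (1 + v) * (j - 1)) ^ 2) by (unfold w; ring).
    apply pow_incr; split; [nra|].
    (* This square is exactly the difference of the two bases; it vanishes at [j = 1 + 2 / sqrt 3],
       where the constant is sharp. *)
    assert (hs := pow2_ge_0 (v * (j - 1) - 2)); nra. }
  assert (main_u : w * (u * (t + 3) - 3 * t * (t - 1)) <= (t - 9) * u ^ 2).
  { enough (0 <= (j * (j - 3)) ^ 2 / (j - 1) ^ 5
      * ((3 * j ^ 2 - 2 * j + 3) ^ 2 - 4 * w * (j - 1) ^ 2)) by lra.
    apply Rmult_le_pos; [|lra].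
    apply Rmult_le_pos; [apply pow2_ge_0 | apply Rlt_le, Rinv_0_lt_compat, pow_lt; lra]. }
  (* [(p * (t + 3) - 3 * t * (t - 1)) / p ^ 2] increases with [p] in this range. *)
  assert (mono : 0 <= (u - p) * (3 * t * (t - 1) * (u + p) - u * (t + 3) * p)).
  { assert (u * (t + 3) <= (t ^ 2 - 2 * t + 9) / 4 * (t + 3)) by (apply Rmult_le_compat_r; lra).
    assert (u * (t + 3) <= 6 * t * (t - 1)) by nra.
    assert (u * (t + 3) * p <= 6 * t * (t - 1) * p) by (apply Rmult_le_compat_r; lra).
    assert (0 <= 3 * t * (t - 1) * (u - p)) by (apply Rmult_le_pos; nra).
    apply Rmult_le_pos; lra. }
  apply (Rmult_le_reg_l (u ^ 2)); [nra|].
  apply Rle_trans with (p ^ 2 * (w * (u * (t + 3) - 3 * t * (t - 1)))).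
  + apply (Rmult_le_compat_l w) in mono; lra.
  + apply (Rmult_le_compat_l (p ^ 2)) in main_u; [lra | apply pow2_ge_0].
Qed.

(** * From inequalities in [q] and [t] to distances *)

(** Both sides are nonnegative, so their squares may be compared, and these share the factor [r2],
    the squared inradius. *)
Lemma mul_D_le (A B C : point) (i j : nat) (L U : R) :
  ~ collinear A B C -> (2 <= i <= 10)%nat -> (2 <= j <= 10)%nat -> 0 <= L -> 0 <= U ->
  (forall q t, blundon q t -> L ^ 2 * incenter_sq i q t <= U ^ 2 * incenter_sq j q t) ->
  L * D A B C 1 i <= U * D A B C 1 j.
Proof.
intros hABC hi hj hL hU H.
destruct (triangle_strict A B C hABC) as (hx & hy & hz).
set (x := (point_dist C A + point_dist A B - point_dist B C) / 2).
set (y := (point_dist A B + point_dist B C - point_dist C A) / 2).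
set (z := (point_dist B C + point_dist C A - point_dist A B) / 2).
assert (px : 0 < x) by (unfold x; lra).
assert (py : 0 < y) by (unfold y; lra).
assert (pz : 0 < z) by (unfold z; lra).
assert (hD := fun n => D_sq A B C x y z n ltac:(unfold y, z; field) ltac:(unfold z, x; field)
  ltac:(unfold x, y; field) px py pz).
assert (hb := blundon_tangent_lengths x y z px py pz).
clearbody x y z; cbv zeta in hD, hb; set (r2 := x * y * z / (x + y + z)) in *.
assert (hr : 0 < r2).
{ apply Rmult_lt_0_compat; [repeat apply Rmult_lt_0_compat; trivial|].
  apply Rinv_0_lt_compat; lra. }
assert (pD := fun n => point_dist_ge0 (center A B C 1) (center A B C n)).
apply Rsqr_incr_0; [|apply Rmult_le_pos; [lra | apply pD]..].
rewrite !Rsqr_pow2, !Rpow_mult_distr, !hD by assumption.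
apply H, (Rmult_le_compat_l r2) in hb; lra.
Qed.

Theorem theorem1 (A B C : point) (hABC : ~ collinear A B C) :
  D A B C 1 2 <= 2 / 3 * D A B C 1 3 /\
  2 * sqrt 2 / 3 * D A B C 1 6 <= D A B C 1 2 /\
  1 / 3 * D A B C 1 7 <= D A B C 1 2 /\
  D A B C 1 2 = 1 / 3 * D A B C 1 8 /\
  1 / 3 * D A B C 1 9 <= D A B C 1 2 <= 2 / 3 * D A B C 1 9 /\
  D A B C 1 2 = 2 / 3 * D A B C 1 10 /\
  1 / 2 * D A B C 1 4 <= D A B C 1 3 /\
  2 * D A B C 1 5 <= D A B C 1 3 /\
  (1 + sqrt 3) * D A B C 1 6 <= D A B C 1 3 /\
  (3 / 2 + sqrt 2) * D A B C 1 7 <= D A B C 1 3 /\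
  1 / 2 * D A B C 1 8 <= D A B C 1 3 /\
  1 * D A B C 1 9 <= D A B C 1 3 /\
  1 * D A B C 1 10 <= D A B C 1 3 /\
  1 * D A B C 1 6 <= D A B C 1 4 /\
  2 * D A B C 1 7 <= D A B C 1 4 /\
  1 / 3 * D A B C 1 7 <= D A B C 1 6 /\
  D A B C 1 6 <= 1 / (2 * sqrt 2) * D A B C 1 8 /\
  D A B C 1 6 <= 1 / 2 * D A B C 1 9 /\
  D A B C 1 6 <= 1 / sqrt 2 * D A B C 1 10 /\
  D A B C 1 7 <= 1 * D A B C 1 8 /\
  D A B C 1 7 <= 1 * D A B C 1 9 /\
  D A B C 1 7 <= 2 * D A B C 1 10 /\
  1 * D A B C 1 9 <= D A B C 1 8 <= 2 * D A B C 1 9 /\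
  D A B C 1 8 = 2 * D A B C 1 10 /\
  1 * D A B C 1 10 <= D A B C 1 9 <= 2 * D A B C 1 10.
Proof.
assert (s2 := sqrt_lt_R0 2 ltac:(lra)); assert (s3 := sqrt_lt_R0 3 ltac:(lra)).
assert (e2 : sqrt 2 ^ 2 = 2) by (apply pow2_sqrt; lra).
assert (le_mul : forall i j U, (2 <= i <= 10)%nat -> (2 <= j <= 10)%nat -> 0 <= U ->
  (forall q t, blundon q t -> incenter_sq i q t <= U ^ 2 * incenter_sq j q t) ->
  D A B C 1 i <= U * D A B C 1 j).
{ intros i j U hi hj hU H; rewrite <- (Rmult_1_l (D A B C 1 i)).
  apply mul_D_le; trivial; [lra|]; intros q t h; specialize (H q t h); lra. }
assert (mul_le : forall i j L, (2 <= i <= 10)%nat -> (2 <= j <= 10)%nat -> 0 <= L ->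
  (forall q t, blundon q t -> L ^ 2 * incenter_sq i q t <= incenter_sq j q t) ->
  L * D A B C 1 i <= D A B C 1 j).
{ intros i j L hi hj hL H; rewrite <- (Rmult_1_l (D A B C 1 j)).
  apply mul_D_le; trivial; [lra|]; intros q t h; specialize (H q t h); lra. }
assert (c2 : 0 <= 2 * sqrt 2 / 3 /\ (2 * sqrt 2 / 3) ^ 2 = 8 / 9).
{ split; [lra|]; replace ((2 * sqrt 2 / 3) ^ 2) with (4 / 9 * sqrt 2 ^ 2) by field; lra. }
assert (c8 : 0 <= 1 / (2 * sqrt 2) /\ (1 / (2 * sqrt 2)) ^ 2 = 1 / 8).
{ split; [apply Rmult_le_pos; [|apply Rlt_le, Rinv_0_lt_compat]; lra|].
  replace ((1 / (2 * sqrt 2)) ^ 2) with (/ (4 * sqrt 2 ^ 2)) by (field; lra); rewrite e2; lra. }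
assert (c10 : 0 <= 1 / sqrt 2 /\ (1 / sqrt 2) ^ 2 = 1 / 2).
{ split; [apply Rmult_le_pos; [|apply Rlt_le, Rinv_0_lt_compat]; lra|].
  replace ((1 / sqrt 2) ^ 2) with (/ (sqrt 2 ^ 2)) by (field; lra); rewrite e2; lra. }
repeat match goal with |- _ /\ _ => split end.
all: try apply Rle_antisym.
all: (apply le_mul || apply mul_le); [lia | lia | lra |]; intros q t h.
all: assert (f1 := nagel_le_circumcenter q t h);
  assert (f2 := orthocenter_le_circumcenter q t h);
  assert (f3 := nine_point_le_circumcenter q t h);
  assert (f4 := mittenpunkt_le_circumcenter q t h);
  assert (f5 := nagel_le_mittenpunkt q t h);
  assert (f6 := symmedian_le_mittenpunkt q t h);
  assert (f7 := gergonne_le_nagel q t h);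
  assert (f8 := gergonne_le_circumcenter q t h);
  assert (f9 := gergonne_le_orthocenter q t h);
  assert (f10 := mittenpunkt_le_nagel q t h);
  assert (f11 := gergonne_le_mittenpunkt q t h);
  assert (f12 := symmedian_le_nagel q t h);
  assert (f13 := gergonne_le_symmedian q t h);
  assert (f14 := symmedian_le_orthocenter q t h);
  assert (f15 := symmedian_le_circumcenter q t h);
  (* The centroid, the Spieker center and the Nagel point lie at distances [2 : 3 : 6] from the
     incenter, so every bound on the first two follows from one on the Nagel point. *)
  assert (centroid : incenter_sq 2 q t = incenter_sq 8 q t / 9) by reflexivity;
  assert (spieker : incenter_sq 10 q t = incenter_sq 8 q t / 4) by reflexivity;
  rewrite ?(proj2 c2), ?(proj2 c8), ?(proj2 c10), ?centroid, ?spieker.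
all: assert (0 <= incenter_sq 8 q t) by (destruct (gerretsen q t h); unfold incenter_sq; lra).
all: try assumption; try lra.
Qed.
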